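(* For every integer $n \ge 6$ with $n \neq 7$ there exists an indecomposable Anosov real Lie algebra of dimension $n$.
   Context: A rational Lie algebra of dimension $n$ is called Anosov if it admits a Lie algebra automorphism $\tau$ that is hyperbolic (none of its complex eigenvalues has modulus $1$) and such that the matrix of $\tau$ in some basis lies in $\mathrm{GL}_n(\mathbb{Z})$. A real Lie algebra is called Anosov if it admits a rational form which is Anosov; equivalently, if it admits a hyperbolic automorphism $\tau$ whose matrix lies in $\mathrm{GL}_n(\mathbb{Z})$ with respect to some $\mathbb{Z}$-basis (a basis with integer structure constants). A Lie algebra is indecomposable if it cannot be expressed as a direct sum of proper Lie ideals. *)

(* Defs.v *)
From HB Require Import structures.
From mathcomp Require Import all_boot all_order all_algebra.
From mathcomp Require Import reals complex.

Set Implicit Arguments.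
Unset Strict Implicit.
Unset Printing Implicit Defensive.

Import Order.TTheory GRing.Theory Num.Theory.
Local Open Scope ring_scope.

HB.mixin Record isLieAlgebra (F : fieldType) V of Vector F V := {
  lie : V -> V -> V;
  lie_linearl : forall z : V, linear (lie^~ z);
  lie_linearr : forall z : V, linear (lie z);
  liexx : forall x : V, lie x x = 0;
  lie_jacobi : forall x y z : V,
    lie x (lie y z) + lie y (lie z x) + lie z (lie x y) = 0
}.

#[short(type="lieAlgType")]
HB.structure Definition LieAlgebra (F : fieldType) :=
  {V of Vector F V & isLieAlgebra F V}.

Section LieAlgebraTheory.
Variables (F : fieldType) (L : lieAlgType F).

Definition lie_ideal (I : {vspace L}) : Prop :=
  forall x y : L, y \in I -> lie x y \in I.

(* Two summands suffice: in a direct sum of several proper ideals, discard the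
   zero ones and group all but one of the others into a single proper ideal. *)
Definition indecomposable : Prop :=
  ~ exists I J : {vspace L},
      [/\ lie_ideal I, lie_ideal J, I != fullv & J != fullv] /\
      (directv (I + J) /\ (I + J)%VS = fullv).

Definition lie_automorphism (tau : 'End(L)) : Prop :=
  bijective tau /\ {morph tau : x y / lie x y >-> lie x y}.

End LieAlgebraTheory.

(* The complex numbers are R[i]; the choice of the basis [vbasis fullv] is
   immaterial, since the eigenvalues of a matrix are invariant under
   conjugation. [mxof] acts on row vectors, so it is the transpose of the matrix
   with images in columns; neither the eigenvalues nor membership in GL_n(Z)
   depend on this. *)
Definition hyperbolic (R : realType) (V : vectType rat) (tau : 'End(V)) : Prop :=
  forall z : R[i],
    eigenvalue
      (map_mx ratr (passmx.mxof (vbasis {:V}) (vbasis {:V}) tau)) z ->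
    `|z| != 1.

Definition integral_in_some_basis (V : vectType rat) (tau : 'End(V)) : Prop :=
  exists b : (\dim {:V}).-tuple V, basis_of {:V} b /\
  exists A : 'M[int]_(\dim {:V}),
    A \in unitmx /\ passmx.mxof b b tau = map_mx intr A.

Definition rational_anosov (R : realType) (H : lieAlgType rat) : Prop :=
  exists tau : 'End(H),
    [/\ lie_automorphism tau, hyperbolic R tau & integral_in_some_basis tau].

(* [iota] exhibits [H] as a rational form of [L], i.e. its R-linear extension
   R (x)_Q H -> L is an isomorphism of Lie algebras. *)
Definition is_rational_form (R : realType) (L : lieAlgType R)
    (H : lieAlgType rat) (iota : {linear H -> L | ratr \; *:%R}) : Prop :=
  {morph iota : x y / lie x y >-> lie x y} /\
  forall b : seq H, basis_of {:H} b -> basis_of {:L} (map iota b).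

Definition anosov (R : realType) (L : lieAlgType R) : Prop :=
  exists (H : lieAlgType rat) (iota : {linear H -> L | ratr \; *:%R}),
    is_rational_form iota /\ rational_anosov R H.

(* Main.v *)
From HB Require Import structures.
Require Import Defs.
From mathcomp Require Import all_boot all_order all_algebra.
From mathcomp Require Import reals complex.
From mathcomp Require Import zify ring.

(** All the algebras are two-step nilpotent, L = U + Z with a bracket
    beta : U x U -> Z, and there are two families.
    - For n = 3k + 3 and n = 10: U consists of k vectors of length d, Z is the
      exterior square of the space of vectors of length d, and beta is the sum of
      the wedge products of corresponding vectors, with d = 3 (respectively
      d = 4, k = 1).
    - Otherwise n = 2w + 3m with w = 1 or 2 and w < m: U is the sum of the
      2 x w matrices x and of the vectors t of length m, Z is the space of 2 x m
      matrices, and beta ((x, t), (x', t')) = x K(t') - x' K(t), where K(t) is the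
      w x m matrix with rows t, t h, ..., t h^(w-1) and h is the companion matrix
      of X^m - 3X + 1.

    The automorphism acts on vectors by h, on Z by what compatibility with the
    bracket forces, and on the two rows of x by a matrix g of trace 9 and
    determinant 1.  That no eigenvalue has modulus 1 follows from norm
    estimates only: 3 > 1 + 1 for h, and 9 > 4 + 4 for the action g z h on Z,
    since h and its inverse have l1-norm at most 4.

    A splitting of L into ideals gives an idempotent of the centroid, and in both
    families the centroid acts on U by scalars. *)

Set Implicit Arguments.
Unset Strict Implicit.
Unset Printing Implicit Defensive.

Import Order.TTheory GRing.Theory Num.Theory.
Local Open Scope ring_scope.

(** * Two-step nilpotent Lie algebras from alternating bilinear maps *)

Record alternating_bilinear (F : fieldType) (U Z : vectType F)
    (beta : U -> U -> Z) : Prop := AlternatingBilinear {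
  alt_linearl : forall v, linear (beta^~ v);
  alt_linearr : forall u, linear (beta u);
  alt_diag : forall u, beta u u = 0
}.

(** Indexing the type by [alt] lets the Lie algebra instance on [U * Z] be inferred from the type
    alone. *)
Definition two_step (F : fieldType) (U Z : vectType F) (beta : U -> U -> Z)
  (alt : alternating_bilinear beta) : Type := (U * Z)%type.

Section TwoStep.
Variables (F : fieldType) (U Z : vectType F) (beta : U -> U -> Z).
Variable alt : alternating_bilinear beta.
Local Notation L := (two_step alt).

HB.instance Definition _ := Vector.copy L (U * Z)%type.

Definition two_step_lie (x y : L) : L := (0, beta x.1 y.1).

Lemma altDl u u' v : beta (u + u') v = beta u v + beta u' v.
Proof. by have := alt_linearl alt v 1 u u'; rewrite !scale1r. Qed.

Lemma altDr u v v' : beta u (v + v') = beta u v + beta u v'.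
Proof. by have := alt_linearr alt u 1 v v'; rewrite !scale1r. Qed.

Lemma alt0l v : beta 0 v = 0.
Proof. by apply: (addrI (beta 0 v)); rewrite -altDl !addr0. Qed.

Lemma alt0r u : beta u 0 = 0.
Proof. by apply: (addrI (beta u 0)); rewrite -altDr !addr0. Qed.

Lemma altZl a u v : beta (a *: u) v = a *: beta u v.
Proof. by have := alt_linearl alt v a u 0; rewrite !addr0 alt0l addr0. Qed.

Lemma two_step_linearl z : linear (two_step_lie^~ z).
Proof.
move=> a x y; congr pair; first by rewrite /= scaler0 addr0.
exact: (alt_linearl alt).
Qed.

Lemma two_step_linearr z : linear (two_step_lie z).
Proof.
move=> a x y; congr pair; first by rewrite /= scaler0 addr0.
exact: (alt_linearr alt).
Qed.

Lemma two_step_liexx x : two_step_lie x x = 0.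
Proof. by rewrite /two_step_lie (alt_diag alt). Qed.

Lemma two_step_jacobi x y z :
  two_step_lie x (two_step_lie y z) + two_step_lie y (two_step_lie z x)
  + two_step_lie z (two_step_lie x y) = 0.
Proof. by rewrite /two_step_lie /= !alt0r; congr pair; rewrite !addr0. Qed.

HB.instance Definition _ := isLieAlgebra.Build F L
  two_step_linearl two_step_linearr two_step_liexx two_step_jacobi.

Lemma two_step_lieE (x y : L) : lie x y = (0, beta x.1 y.1).
Proof. by []. Qed.

End TwoStep.

(** * Direct sum decompositions and the centroid *)

Section Centroid.
Variables (F : fieldType) (L : lieAlgType F).

Lemma lieDl (x y z : L) : lie (x + y) z = lie x z + lie y z.
Proof. by have := lie_linearl z 1 x y; rewrite !scale1r. Qed.

Lemma lieDr (x y z : L) : lie z (x + y) = lie z x + lie z y.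
Proof. by have := lie_linearr z 1 x y; rewrite !scale1r. Qed.

Lemma lieC (x y : L) : lie x y = - lie y x.
Proof.
apply/eqP; rewrite -addr_eq0; have := liexx (x + y).
by rewrite lieDl !lieDr !liexx add0r addr0 => ->.
Qed.

(* The projection attached to a splitting into two ideals is an idempotent of
   the centroid. *)
Lemma indecomposable_centroid :
  (forall pi : 'End(L),
     (forall x, pi (pi x) = pi x) ->
     (forall x y, pi (lie x y) = lie (pi x) y) ->
     pi = 0 \/ pi = \1%VF) ->
  indecomposable L.
Proof.
move=> centroid [I [J [[idI idJ properI properJ] [dIJ fullIJ]]]].
have capIJ : (I :&: J = 0)%VS by apply/directv_addP.
(* Such a bracket lies in both ideals. *)
have lieIJ x y : x \in I -> y \in J -> lie x y = 0.
  move=> xI yJ; apply/eqP; rewrite -memv0 -capIJ memv_cap idJ // andbT.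
  by rewrite lieC memvN idI.
pose pi := daddv_pi I J; pose pi' := daddv_pi J I.
have split x : pi x + pi' x = x by apply: daddv_pi_add; rewrite ?fullIJ ?memvf.
have piI x : pi x \in I by exact: memv_pi.
have piJ x : pi' x \in J by exact: memv_pi.
have pi0 y : y \in J -> pi y = 0.
  move=> yJ; have := split y; rewrite [pi' y]daddv_pi_id 1?capvC //.
  by move/(canRL (addrK _)); rewrite subrr.
case: (centroid pi).
- by move=> x; apply: daddv_pi_proj.
- move=> x y.
  (* Mixed brackets vanish, so a bracket with an element of [I] sees only [I]-components. *)
  have eqI u v : u \in I -> lie u v = lie u (pi v).
    by move=> uI; rewrite -{1}[v]split lieDr (lieIJ _ (pi' v)) ?addr0.
  rewrite [RHS]eqI // -{1}[x]split lieDl linearD /= eqI //.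
  rewrite [X in _ + X]pi0 ?addr0; last first.
    by rewrite lieC memvN; apply: idJ.
  by rewrite daddv_pi_id // lieC memvN; apply: idI.
- move=> pi_eq0; case/negP: properJ; apply/eqP/vspaceP => x.
  by rewrite memvf -[x]split pi_eq0 lfunE /= add0r piJ.
- move=> pi_eq1; case/negP: properI; apply/eqP/vspaceP => x.
  by rewrite memvf; have := piI x; rewrite pi_eq1 lfunE /= => ->.
Qed.

End Centroid.

(** * An indecomposability criterion for two-step algebras *)

Section TwoStepIndecomposable.
Variables (F : fieldType) (U Z : vectType F) (beta : U -> U -> Z).
Variable alt : alternating_bilinear beta.
Local Notation L := (two_step alt).

(** An idempotent [pi] of the centroid preserves Z by nondegeneracy and acts on U modulo Z by a
    scalar [c], hence also on Z, which the brackets span. So [pi] maps (u, z) to (c u, g u + c z).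
    Idempotence forces c = 0 or 1 and then g = 0. Spanning is stated dually: an endomorphism of Z
    killing all brackets is zero. *)
Lemma two_step_indecomposable (u0 : U) : u0 != 0 ->
  (forall u, (forall v, beta u v = 0) -> u = 0) ->
  (forall f : 'End(Z), (forall u v, f (beta u v) = 0) -> f = 0) ->
  (forall (f : {linear U -> U}) (h : {linear Z -> Z}),
     (forall u v, h (beta u v) = beta (f u) v) ->
     (forall u v, h (beta u v) = beta u (f v)) ->
     exists c, forall u, f u = c *: u) ->
  indecomposable L.
Proof.
move=> u0N0 ndeg surj scal; apply: indecomposable_centroid => pi pi_id pi_lie.
have pi_lie' x y : pi (lie x y) = lie x (pi y).
  by rewrite (lieC x y) linearN /= pi_lie [RHS]lieC.
pose f (u : U) : U := (pi (u, 0) : L).1.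
pose h (z : Z) : Z := (pi (0, z) : L).2.
have f_lin : linear f.
  move=> a u v; rewrite /f.
  have -> : ((a *: u + v, 0) : L) = a *: ((u, 0) : L) + ((v, 0) : L).
    by congr pair; rewrite /= scaler0 addr0.
  by rewrite linearP.
have h_lin : linear h.
  move=> a u v; rewrite /h.
  have -> : ((0, a *: u + v) : L) = a *: ((0, u) : L) + ((0, v) : L).
    by congr pair; rewrite /= scaler0 addr0.
  by rewrite linearP.
pose fL := GRing.isLinear.Build _ _ _ _ f f_lin.
pose f' : {linear U -> U} := HB.pack f fL.
pose hL := GRing.isLinear.Build _ _ _ _ h h_lin.
pose h' : {linear Z -> Z} := HB.pack h hL.
(* Since (0, z) is central, so is its image, whose U-component therefore lies in the radical of
   [beta]. *)
have piZ z : pi (0, z) = (0, h z) :> L.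
  rewrite /h; case E: (pi _) => [u z'] /=; congr pair; apply: ndeg => v.
  have := pi_lie (0, z) (v, 0); rewrite !two_step_lieE E /= alt0l //.
  by rewrite linear0 => -[->].
have split (x : L) : x = (x.1, 0) + (0, x.2) :> L.
  by case: x => u z; congr pair; rewrite /= ?addr0 ?add0r.
have pi1 x : (pi x).1 = f x.1.
  by rewrite [in LHS](split x) linearD /= piZ addr0.
have hl u v : h (beta u v) = beta (f u) v.
  have := pi_lie (u, 0) (v, 0); rewrite !two_step_lieE piZ /= => -[->].
  by [].
have hr u v : h (beta u v) = beta u (f v).
  have := pi_lie' (u, 0) (v, 0); rewrite !two_step_lieE piZ /= => -[->].
  by [].
have [c f'c] := scal f' h' hl hr; have fc u : f u = c *: u := f'c u.
have hc z : h z = c *: z.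
  pose k := linfun h' - c *: \1%VF.
  have kE y : k y = h y - c *: y.
    by rewrite add_lfunE opp_lfunE scale_lfunE lfunE id_lfunE.
  have k0 : k = 0 by apply: surj => u v; rewrite kE hl fc altZl // subrr.
  by have /eqP := kE z; rewrite k0 lfunE /= eq_sym subr_eq0 => /eqP.
have idU u : f (f u) = f u.
  by rewrite [RHS]/f -(pi_id (u, 0)) pi1.
have c01 : (c == 0) || (c == 1).
  have /eqP := idU u0; rewrite !fc -subr_eq0 -scalerBr scaler_eq0.
  by rewrite -{2}[u0]scale1r -scalerBl scaler_eq0 (negPf u0N0) orbF subr_eq0.
pose g (u : U) : Z := (pi (u, 0) : L).2.
have piE u z : pi (u, z) = (c *: u, g u + c *: z) :> L.
  rewrite [in LHS](split (u, z)) linearD /= piZ hc.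
  by congr pair; rewrite /= ?addr0 ?pi1 ?fc.
(* The Z-component of pi (pi (u, 0)) = pi (u, 0) reads g (c u) + c g u = g u. *)
have g0 u : g u = 0.
  have := congr1 (fun x : L => x.2) (pi_id (u, 0)).
  rewrite (piE u) scaler0 addr0 piE /=.
  case/orP: c01 => /eqP ->; rewrite ?scale0r ?scale1r ?addr0.
    by rewrite /g -[(0, 0)]/(0 : L) linear0 => <-.
  by move/eqP; rewrite -subr_eq0 addrK => /eqP.
by case/orP: c01 => /eqP c_eq; [left | right]; apply/lfunP => -[u z];
  rewrite piE c_eq g0 add0r ?scale0r ?scale1r lfunE.
Qed.
End TwoStepIndecomposable.

(** * Rational forms, hyperbolicity and integrality tested on a convenient basis *)

Section RationalStructures.

Lemma size_basis_of (F : fieldType) (V : vectType F) (U : {vspace V})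
    (X : seq V) : basis_of U X -> size X = \dim U.
Proof. by move=> XB; rewrite (size_basis (X := in_tuple X)). Qed.

(** Rational coordinates with respect to [b] express [iota e] through [iota b], so [iota b] spans;
    counting dimensions gives the rest. *)
Lemma semilinear_basis (F : numFieldType) (V : vectType rat) (W : vectType F)
    (iota : {linear V -> W | ratr \; *:%R}) (e b : seq V) :
  basis_of {:V} e -> basis_of {:W} (map iota e) -> basis_of {:V} b ->
  basis_of {:W} (map iota b).
Proof.
move=> eB ieB bB; rewrite basisEdim size_map.
rewrite (size_basis_of bB) -(size_basis_of eB) -(size_map iota).
rewrite (size_basis_of ieB).
rewrite leqnn andbT -(span_basis ieB); apply/span_subvP => _ /mapP[v ve ->].
have vb : v \in <<in_tuple b>>%VS by rewrite (span_basis bB) memvf.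
rewrite (coord_span vb) linear_sum /=; apply: memv_suml => i _.
rewrite linearZ /=; apply: memvZ; apply: memv_span; apply: map_f.
by rewrite mem_nth.
Qed.

(** A row eigenvector of the matrix is the coordinate vector of an eigenvector of [T]. Eigenvalues
    can thus be studied on a concrete complex model, without knowing the abstract basis [vbasis]. *)
Lemma hyperbolic_extension (R : realType) (V : vectType rat)
    (W : vectType R[i]) (iota : {linear V -> W | ratr \; *:%R})
    (tau : 'End(V)) (T : {linear W -> W}) (e : seq V) :
  basis_of {:V} e -> basis_of {:W} (map iota e) ->
  (forall v, T (iota v) = iota (tau v)) ->
  (forall z w, `|z| = 1 -> T w = z *: w -> w = 0) ->
  hyperbolic R tau.
Proof.
move=> eB ieB Tiota noeig z /eigenvalueP[r rM rN0].
apply/eqP => z1; case/negP: rN0; apply/eqP.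
have bB := vbasisP {:V}; set b := vbasis _ in rM bB.
have ibB := semilinear_basis eB ieB bB.
pose w : W := \sum_i r 0 i *: iota b`_i.
have w0 : w = 0.
  apply: (noeig z) => //; rewrite linear_sum.
  transitivity (\sum_j (r *m map_mx ratr (passmx.mxof b b tau)) 0 j *: iota b`_j).
    under [RHS]eq_bigr do rewrite mxE scaler_suml.
    rewrite exchange_big /=; apply: eq_bigr => i _.
    rewrite linearZ /= Tiota -[in LHS](passmx.vecof_delta b i).
    rewrite (passmx.hom_vecof _ bB) linear_sum scaler_sumr; apply: eq_bigr => j _.
    by rewrite linearZ /= scalerA -rowE !mxE.
  by rewrite rM scaler_sumr; apply: eq_bigr => j _; rewrite mxE scalerA.
(* The family [iota b] is free over the complex numbers, so w = 0 makes all coordinates [r]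
   vanish. *)
have := basis_free ibB; rewrite -[map _ _]/(tval (map_tuple iota b)).
move=> /freeP /(_ (fun i => r 0 i)) r0; apply/rowP => i; rewrite mxE; apply: r0.
rewrite -[RHS]w0; apply: eq_bigr => j _; congr (_ *: _).
by rewrite (nth_map 0) ?size_tuple.
Qed.

(** The integer matrices of [tau] and [tau'] have product 1, which puts the matrix of [tau] in
    GL_n(Z). *)
Lemma integral_in_basis (V : vectType rat) (tau tau' : 'End(V))
    (b : (\dim {:V}).-tuple V) :
  basis_of {:V} b -> (tau' \o tau = \1)%VF ->
  (forall i j, coord b j (tau b`_i) \is a Num.int) ->
  (forall i j, coord b j (tau' b`_i) \is a Num.int) ->
  integral_in_some_basis tau.
Proof.
move=> bB tauK tau_int tau'_int; exists b; split=> //.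
pose A (f : 'End(V)) : 'M[int]_(\dim {:V}) :=
  \matrix_(i, j) Num.floor (coord b j (f b`_i)).
have AE (f : 'End(V)) : (forall i j, coord b j (f b`_i) \is a Num.int) ->
    passmx.mxof b b f = map_mx intr (A f).
  move=> f_int; apply/matrixP => i j; rewrite !mxE passmx.vecof_delta.
  by rewrite floorK.
exists (A tau); split; last exact: AE.
have AA' : map_mx intr (A tau *m A tau') = 1%:M :> 'M[rat]_(\dim {:V}).
  rewrite map_mxM -!AE // -passmx.mxof_comp // tauK.
  by rewrite passmx.mxof1 ?(basis_free bB).
have /mulmx1_unit[] // : A tau *m A tau' = 1%:M.
apply/matrixP => i j; apply: (@intr_inj rat).
by have := congr1 (fun M : 'M_ _ => M i j) AA'; rewrite !mxE => ->; case: (_ == _).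
Qed.

End RationalStructures.

(** * Vector spaces of matrices, natural in the scalars *)

(** An induction principle used in two ways: [f = id] gives spanning and linearity arguments,
    [f = intr] gives integrality. *)
Lemma matrix_closure (K : pzRingType) (F : nzRingType) (f : K -> F) (p q : nat)
    (P : 'M[F]_(p, q) -> Prop) :
  P 0 -> (forall A B, P A -> P B -> P (A + B)) ->
  (forall c i j, P (f c *: delta_mx i j)) ->
  forall A : 'M[K]_(p, q), P (map_mx f A).
Proof.
move=> P0 PD Pdelta A; rewrite [map_mx f A]matrix_sum_delta.
by elim/big_ind: _ => // i _; elim/big_ind: _ => // j _; rewrite mxE.
Qed.

Section MatrixModel.
Variables p q r s m n : nat.

(* Naturality in the scalars K gives the rational form and the extension to the
   complex numbers; a component that is not needed is taken of size 0 x 0. *)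
Definition mxU (K : Type) : Type := ('M[K]_(p, q) * 'M[K]_(r, s))%type.
Definition mxV (K : Type) : Type := (mxU K * 'M[K]_(m, n))%type.

HB.instance Definition _ (K : nzRingType) :=
  Vector.copy (mxU K) ('M[K]_(p, q) * 'M[K]_(r, s))%type.
HB.instance Definition _ (K : nzRingType) :=
  Vector.copy (mxV K) (mxU K * 'M[K]_(m, n))%type.

Definition map_mxU (K K' : Type) (f : K -> K') (u : mxU K) : mxU K' :=
  (map_mx f u.1, map_mx f u.2).
Definition map_mxV (K K' : Type) (f : K -> K') (x : mxV K) : mxV K' :=
  (map_mxU f x.1, map_mx f x.2).

Definition mxV_basis (K : nzRingType) : seq (mxV K) :=
  [seq (delta_mx ij.1 ij.2, 0, 0) | ij <- enum {: 'I_p * 'I_q}] ++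
  [seq (0, delta_mx ij.1 ij.2, 0) | ij <- enum {: 'I_r * 'I_s}] ++
  [seq (0, 0, delta_mx ij.1 ij.2) | ij <- enum {: 'I_m * 'I_n}].

Lemma mxV_closure (K : pzRingType) (F : nzRingType) (f : K -> F)
    (P : mxV F -> Prop) :
  P 0 -> (forall x y, P x -> P y -> P (x + y)) ->
  (forall c e, e \in mxV_basis F -> P (f c *: e)) ->
  forall x : mxV K, P (map_mxV f x).
Proof.
move=> P0 PD Pe [[x1 x2] x3].
have -> : map_mxV f (x1, x2, x3) =
    (map_mx f x1, 0, 0) + (0, map_mx f x2, 0) + (0, 0, map_mx f x3) :> mxV F.
  by congr (_, _, _); rewrite /= ?addr0 ?add0r.
apply: (PD); [apply: (PD)|].
- apply: (matrix_closure (P := fun A => P (A, 0, 0)));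
    [by [] | move=> A B PA PB | move=> c i j].
    have := PD _ _ PA PB; congr P.
    by congr (_, _, _); rewrite /= ?addr0.
  have /(Pe c) : (delta_mx i j, 0, 0) \in mxV_basis F.
    by rewrite mem_cat (map_f _ (x := (i, j))) ?mem_enum.
  by congr P; congr (_, _, _); rewrite /= scaler0.
- apply: (matrix_closure (P := fun A => P (0, A, 0)));
    [by [] | move=> A B PA PB | move=> c i j].
    have := PD _ _ PA PB; congr P.
    by congr (_, _, _); rewrite /= ?addr0.
  have /(Pe c) : (0, delta_mx i j, 0) \in mxV_basis F.
    by rewrite !mem_cat (map_f (fun ij => (0, delta_mx ij.1 ij.2, 0))
      (x := (i, j))) ?mem_enum ?orbT.
  by congr P; congr (_, _, _); rewrite /= scaler0.
- apply: (matrix_closure (P := fun A => P (0, 0, A)));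
    [by [] | move=> A B PA PB | move=> c i j].
    have := PD _ _ PA PB; congr P.
    by congr (_, _, _); rewrite /= ?addr0.
  have /(Pe c) : (0, 0, delta_mx i j) \in mxV_basis F.
    by rewrite !mem_cat (map_f (fun ij => (0, 0, delta_mx ij.1 ij.2))
      (x := (i, j))) ?mem_enum ?orbT.
  by congr P; congr (_, _, _); rewrite /= scaler0.
Qed.

Lemma dim_mxV (F : fieldType) : \dim {:mxV F} = (p * q + r * s + m * n)%N.
Proof. by rewrite dimvf. Qed.

Lemma mxV_basisP (F : fieldType) : basis_of {:mxV F} (mxV_basis F).
Proof.
rewrite basisEdim; apply/andP; split.
  apply/subvP => x _; have -> : x = map_mxV id x.
    by case: x => [[x1 x2] x3]; rewrite /map_mxV /map_mxU /= !map_mx_id.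
  apply: (mxV_closure (P := fun y => y \in <<mxV_basis F>>%VS)).
  - exact: mem0v.
  - by move=> y z; apply: memvD.
  - by move=> c e eb; apply/memvZ/memv_span.
have size_deltas a b T (f : 'I_a * 'I_b -> T) :
    size [seq f ij | ij <- enum {: 'I_a * 'I_b}] = (a * b)%N.
  by rewrite size_map -cardE card_prod !card_ord.
by rewrite dim_mxV /mxV_basis !size_cat !size_deltas addnA.
Qed.

Lemma map_mxV_basis (K K' : nzRingType) (f : {rmorphism K -> K'}) :
  map (map_mxV f) (mxV_basis K) = mxV_basis K'.
Proof.
rewrite /mxV_basis !map_cat -!map_comp.
by congr (_ ++ (_ ++ _)); apply: eq_map => ij;
  rewrite /map_mxV /map_mxU /= !map_mx0 ?map_delta_mx.
Qed.

Lemma map_mxV_is_linear (F : numFieldType) :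
  linear_for (ratr \; *:%R) (map_mxV ratr : mxV rat -> mxV F).
Proof.
by move=> a x y; congr (_, _, _); rewrite /= map_mxD map_mxZ.
Qed.

HB.instance Definition _ (F : numFieldType) :=
  GRing.isLinear.Build rat (mxV rat) (mxV F) (ratr \; *:%R)
    (map_mxV ratr : mxV rat -> mxV F) (@map_mxV_is_linear F).


(** The matrices are integral so that one definition acts over the integers, the rationals and the
    complex numbers, compatibly with ring morphisms. *)
Definition mxV_act (P1 : 'M[int]_p) (Q1 : 'M[int]_q) (P2 : 'M[int]_r)
    (Q2 : 'M[int]_s) (P3 : 'M[int]_m) (Q3 : 'M[int]_n) (K : pzRingType)
    (x : mxV K) : mxV K :=
  (map_mx intr P1 *m x.1.1 *m map_mx intr Q1,
   map_mx intr P2 *m x.1.2 *m map_mx intr Q2,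
   map_mx intr P3 *m x.2 *m map_mx intr Q3).

Section Action.
Variables (P1 : 'M[int]_p) (Q1 : 'M[int]_q) (P2 : 'M[int]_r) (Q2 : 'M[int]_s).
Variables (P3 : 'M[int]_m) (Q3 : 'M[int]_n).
Local Notation act := (mxV_act P1 Q1 P2 Q2 P3 Q3).

Lemma mxV_act_is_linear (K : comNzRingType) : linear (@act K).
Proof.
by move=> a x y; congr (_, _, _);
  rewrite /= mulmxDr mulmxDl -scalemxAr -scalemxAl.
Qed.

HB.instance Definition _ (K : comNzRingType) :=
  GRing.isLinear.Build K (mxV K) (mxV K) *:%R (@act K) (@mxV_act_is_linear K).

Lemma map_mx_intr (K K' : pzRingType) (f : {rmorphism K -> K'}) a b
    (A : 'M[int]_(a, b)) : map_mx f (map_mx intr A) = map_mx intr A.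
Proof. by apply/matrixP => i j; rewrite !mxE rmorph_int. Qed.

Lemma mxV_act_map (K K' : pzRingType) (f : {rmorphism K -> K'}) x :
  map_mxV f (act x) = act (map_mxV f x).
Proof. by rewrite /map_mxV /map_mxU /mxV_act /= !map_mxM !map_mx_intr. Qed.

Hypotheses (uP1 : P1 \in unitmx) (uQ1 : Q1 \in unitmx) (uP2 : P2 \in unitmx).
Hypotheses (uQ2 : Q2 \in unitmx) (uP3 : P3 \in unitmx) (uQ3 : Q3 \in unitmx).
Local Notation act' := (mxV_act (invmx P1) (invmx Q1) (invmx P2) (invmx Q2)
  (invmx P3) (invmx Q3)).

Lemma sandwich_invK (K : pzRingType) a b (P : 'M[int]_a) (Q : 'M[int]_b)
    (A : 'M[K]_(a, b)) : P \in unitmx -> Q \in unitmx ->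
  map_mx intr (invmx P) *m (map_mx intr P *m A *m map_mx intr Q)
    *m map_mx intr (invmx Q) = A.
Proof.
move=> uP uQ; rewrite !mulmxA -map_mxM mulVmx // map_mx1 mul1mx.
by rewrite -mulmxA -map_mxM mulmxV // map_mx1 mulmx1.
Qed.

Lemma mxV_actK (K : pzRingType) : cancel (@act K) (@act' K).
Proof. by case=> [[x1 x2] x3]; congr (_, _, _); apply: sandwich_invK. Qed.

Lemma mxV_actVK (K : pzRingType) : cancel (@act' K) (@act K).
Proof.
have invVK a b (P : 'M[int]_a) (Q : 'M[int]_b) (A : 'M[K]_(a, b)) :
    P \in unitmx -> Q \in unitmx -> _ := fun uP uQ =>
  @sandwich_invK K a b (invmx P) (invmx Q) A
    (etrans (unitmx_inv P) uP) (etrans (unitmx_inv Q) uQ).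
case=> [[x1 x2] x3]; have := invVK _ _ _ _ x1 uP1 uQ1.
have := invVK _ _ _ _ x2 uP2 uQ2; have := invVK _ _ _ _ x3 uP3 uQ3.
by rewrite !invmxK => x3E x2E x1E; congr (_, _, _).
Qed.

End Action.

Lemma mxV_integral (x : mxV int) (b : (\dim {:mxV rat}).-tuple (mxV rat)) j :
  tval b = mxV_basis rat -> coord b j (map_mxV intr x) \is a Num.int.
Proof.
move=> bE; have bB : basis_of {:mxV rat} b by rewrite bE mxV_basisP.
apply: (mxV_closure (P := fun y => coord b j y \is a Num.int)).
- by rewrite linear0.
- by move=> y z yint zint; rewrite linearD rpredD.
- move=> c e; rewrite -bE => /(nthP 0)[i ltib <-]; rewrite size_tuple in ltib.
  rewrite linearZ /= (coord_free (Ordinal ltib)) ?(basis_free bB) //.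
  by rewrite rpredM ?intr_int // rpred_nat.
Qed.

End MatrixModel.

(** * An Anosov criterion for two-step algebras on matrix spaces *)

Section MatrixTwoStep.
Variables (R : realType) (p q r s m n : nat).
Variable beta : forall F : numFieldType,
  mxU p q r s F -> mxU p q r s F -> 'M[F]_(m, n).
Hypothesis alt : forall F, alternating_bilinear (@beta F).
Hypothesis beta_ratr : forall u v,
  map_mx ratr (beta u v) = beta (map_mxU ratr u) (map_mxU ratr v) :> 'M[R]_(m, n).

Lemma dim_two_step : \dim {:two_step (alt R)} = (p * q + r * s + m * n)%N.
Proof. exact: dim_mxV. Qed.

Variables (P1 : 'M[int]_p) (Q1 : 'M[int]_q) (P2 : 'M[int]_r) (Q2 : 'M[int]_s).
Variables (P3 : 'M[int]_m) (Q3 : 'M[int]_n).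
Hypotheses (uP1 : P1 \in unitmx) (uQ1 : Q1 \in unitmx) (uP2 : P2 \in unitmx).
Hypotheses (uQ2 : Q2 \in unitmx) (uP3 : P3 \in unitmx) (uQ3 : Q3 \in unitmx).

Hypothesis beta_act : forall u v : mxU p q r s rat,
  beta (map_mx intr P1 *m u.1 *m map_mx intr Q1,
        map_mx intr P2 *m u.2 *m map_mx intr Q2)
       (map_mx intr P1 *m v.1 *m map_mx intr Q1,
        map_mx intr P2 *m v.2 *m map_mx intr Q2)
  = map_mx intr P3 *m beta u v *m map_mx intr Q3.

(** The same construction over the rationals is the rational form, and [beta_act] makes the action
    an automorphism of it. Over the complex numbers the action is componentwise, so an eigenvector
    is excluded one component at a time. *)
Lemma two_step_anosov :
  (forall (z : R[i]) (A : 'M_(p, q)), `|z| = 1 ->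
     map_mx intr P1 *m A *m map_mx intr Q1 = z *: A -> A = 0) ->
  (forall (z : R[i]) (A : 'M_(r, s)), `|z| = 1 ->
     map_mx intr P2 *m A *m map_mx intr Q2 = z *: A -> A = 0) ->
  (forall (z : R[i]) (A : 'M_(m, n)), `|z| = 1 ->
     map_mx intr P3 *m A *m map_mx intr Q3 = z *: A -> A = 0) ->
  anosov (two_step (alt R)).
Proof.
move=> hyp1 hyp2 hyp3.
pose H : lieAlgType rat := two_step (alt rat).
pose act := @mxV_act p q r s m n P1 Q1 P2 Q2 P3 Q3.
pose act' := @mxV_act p q r s m n (invmx P1) (invmx Q1) (invmx P2) (invmx Q2)
  (invmx P3) (invmx Q3).
pose fL : {linear H -> H} := act rat.
pose fL' : {linear H -> H} := act' rat.
pose iota : {linear H -> two_step (alt R) | ratr \; *:%R} :=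
  (map_mxV ratr : mxV p q r s m n rat -> mxV p q r s m n R).
pose iotaC : {linear H -> mxV p q r s m n R[i] | ratr \; *:%R} :=
  (map_mxV ratr : mxV p q r s m n rat -> mxV p q r s m n R[i]).
pose e : seq H := mxV_basis p q r s m n rat.
have eB : basis_of {:H} e := mxV_basisP p q r s m n rat.
have ieB : basis_of {:two_step (alt R)} (map iota e).
  rewrite [map _ _](map_mxV_basis p q r s m n (ratr : {rmorphism rat -> R})).
  exact: mxV_basisP.
have iCeB : basis_of {:mxV p q r s m n R[i]} (map iotaC e).
  rewrite [map _ _](map_mxV_basis p q r s m n (ratr : {rmorphism rat -> R[i]})).
  exact: mxV_basisP.
exists H, iota; split; first split.
- move=> x y; rewrite !two_step_lieE; congr (_, _, _); rewrite /= ?map_mx0 //.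
- by move=> b; apply: semilinear_basis eB ieB.
pose tau : 'End(H) := linfun fL; pose tau' : 'End(H) := linfun fL'.
have tauK : cancel tau tau'.
  by move=> x; rewrite !lfunE; apply: mxV_actK.
have tauVK : cancel tau' tau.
  by move=> x; rewrite !lfunE; apply: mxV_actVK.
exists tau; split.
- split; first by exists tau'.
  move=> x y; rewrite !lfunE; congr (_, _, _); rewrite /= ?mulmx0 ?mul0mx //.
- apply: (hyperbolic_extension (T := act R[i]) eB iCeB).
    by move=> v; rewrite lfunE /=; symmetry; apply: mxV_act_map.
  move=> z [[x1 x2] x3] z1 [/hyp1 x1_0 /hyp2 x2_0 /hyp3 x3_0].
  by rewrite x1_0 // x2_0 // x3_0.
- have e_size : size e == \dim {:H} by rewrite (size_basis_of eB).
  pose b : (\dim {:H}).-tuple H := Tuple e_size.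
  (* The standard basis consists of images of integral vectors, and the integral action keeps them
     integral. *)
  have bE i : exists x : mxV p q r s m n int, b`_i = map_mxV intr x :> mxV p q r s m n rat.
    have -> : tval b = map (map_mxV intr) (mxV_basis p q r s m n int) :> seq H.
      exact/esym/(map_mxV_basis p q r s m n (intr : {rmorphism int -> rat})).
    set ei := mxV_basis _ _ _ _ _ _ int.
    have [lti|gei] := ltnP i (size ei).
      by exists ei`_i; rewrite (nth_map 0).
    exists 0; rewrite nth_default ?size_map //.
    by rewrite /map_mxV /map_mxU /= !map_mx0.
  apply: (integral_in_basis (tau' := tau') (b := b) eB).
  + by apply/lfunP => x; rewrite comp_lfunE id_lfunE tauK.
  + move=> i j; have [x ->] := bE i; rewrite lfunE /=.
    rewrite [X in coord b j X](esym (mxV_act_map _ _ _ _ _ _ intr x)).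
    exact: mxV_integral.
  + move=> i j; have [x ->] := bE i; rewrite lfunE /=.
    rewrite [X in coord b j X](esym (mxV_act_map _ _ _ _ _ _ intr x)).
    exact: mxV_integral.
Qed.
End MatrixTwoStep.

(** * The companion matrix of the trinomial X^(a+2) - 3X + 1 *)

Section Trinomial.
Variable a : nat.

(* The companion matrix of X^(a+2) - 3 X + 1, acting on row vectors. *)
Definition cmx : 'M[int]_a.+2 :=
  \matrix_(i, j) (if i == ord_max then (j == 1%N :> nat)%:R *+ 3 - (j == ord0)%:R
                  else (j == i.+1 :> nat)%:R).

(** The only nonzero entry of the first column is the -1 at the bottom, and its minor is the
    identity matrix. *)
Lemma cmx_unit : cmx \in unitmx.
Proof.
rewrite unitmxE (expand_det_col _ ord0) (bigD1 ord_max) //= big1 ?addr0.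
  rewrite !mxE eqxx /= mul0rn sub0r mulN1r unitrN /cofactor unitrM.
  rewrite unitrX ?unitrN1 //=.
  suff -> : row' ord_max (col' ord0 cmx) = 1%:M by rewrite det1 unitr1.
  apply/matrixP => i j; rewrite !mxE.
  have -> : (lift ord_max i == ord_max) = false.
    by apply/negbTE; rewrite eq_sym neq_lift.
  by rewrite lift0 lift_max eqSS eq_sym.
by move=> i /negPf i_max; rewrite !mxE i_max mul0r.
Qed.

Section Entries.
Variables (K : pzRingType) (k : nat) (A : 'M[K]_(k, a.+2)).

Lemma mul_cmx0 i : (A *m map_mx intr cmx) i ord0 = - A i ord_max.
Proof.
rewrite mxE (bigD1 ord_max) //= big1 ?addr0 => [|j /negPf j_max].
  by rewrite !mxE eqxx /= mul0rn sub0r rmorphN1 mulrN1.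
by rewrite !mxE j_max mulr0.
Qed.

Lemma mul_cmxS i (j : 'I_a.+1) :
  (A *m map_mx intr cmx) i (lift ord0 j) =
  A i (widen_ord (leqnSn _) j) + A i ord_max *+ ((j == ord0) * 3).
Proof.
rewrite mxE big_ord_recr /= addrC [in RHS]addrC; congr (_ + _).
  rewrite !mxE eqxx -!val_eqE lift0 eqSS subr0.
  by case: (_ == _); rewrite ?mul0rn ?mulr0 // mul1n rmorph_nat mulr_natr.
rewrite (bigD1 j) //= big1 ?addr0 => [|l /negPf l_j].
  by rewrite !mxE lift0 eqxx -val_eqE /= ltn_eqF ?ltn_ord // mulr1.
rewrite !mxE; have -> : (widen_ord (leqnSn _) l == ord_max) = false.
  by rewrite -val_eqE /= ltn_eqF.
by rewrite lift0 eqSS [_ == _ :> nat]eq_sym [_ == _]l_j mulr0.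
Qed.

End Entries.
End Trinomial.

(** * Norm estimates excluding eigenvalues of modulus 1 *)

Section Hyperbolicity.
Variable C : numFieldType.

Lemma mulrn_le_eq0 (x : C) m n :
  (m < n)%N -> 0 <= x -> x *+ n <= x *+ m -> x = 0.
Proof.
move=> ltmn; rewrite le_eqVlt => /predU1P[<- // | x0].
by rewrite ler_pMn2l // leqNgt ltmn.
Qed.

Lemma mulrn_norm_le0 (x : C) m n : (m < n)%N -> `|x| *+ n <= `|x| *+ m -> x = 0.
Proof. by move=> ltmn /(mulrn_le_eq0 ltmn (normr_ge0 _)) /normr0_eq0. Qed.

(** In an eigenvector for |z| = 1 the companion shift makes all coordinates of a row equal in
    modulus. The coordinate receiving the coefficient 3 then gives 3 |A_max| <= |A_0| + |A_1| = 2
    |A_max|. *)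
Lemma cmx_hyperbolic a k (z : C) (A : 'M_(k, a.+2)) :
  `|z| = 1 -> A *m map_mx intr (cmx a) = z *: A -> A = 0.
Proof.
move=> z1 Az; apply/matrixP => i j; rewrite mxE.
have Az0 : - A i ord_max = z * A i ord0 by rewrite -mul_cmx0 Az mxE.
have AzS (l : 'I_a.+1) : A i (widen_ord (leqnSn _) l)
    + A i ord_max *+ ((l == ord0) * 3) = z * A i (lift ord0 l).
  by rewrite -mul_cmxS Az mxE.
(* Downward induction from the last coordinate; index 0 is left out because the step from 0 to 1
   involves the coefficient 3. *)
have normA l : (0 < l <= a.+1)%N -> `|A i (inord l)| = `|A i ord_max|.
  move=> /andP[l0 la]; rewrite -(subKn la); move: (a.+1 - l)%N (ltn_subrL l a.+1).
  rewrite l0 /=; elim=> [_|d IHd d_lt].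
    by congr (`|A i _|); apply: val_inj; rewrite /= inordK subn0.
  rewrite -IHd ?(ltnW d_lt) //.
  have e_lt : (a.+1 - d.+1 < a.+1)%N by lia.
  have := AzS (Ordinal e_lt).
  have -> : (Ordinal e_lt == ord0) = false by rewrite -val_eqE /=; lia.
  rewrite mul0n addr0 => /(congr1 Num.norm); rewrite normrM z1 mul1r.
  have -> : widen_ord (leqnSn _) (Ordinal e_lt) = inord (a.+1 - d.+1).
    by apply: val_inj; rewrite /= inordK //; lia.
  move=> ->; congr (`|A i _|); apply: val_inj.
  by rewrite /= /bump inordK; lia.
have Amax : A i ord_max = 0.
  apply: (@mulrn_norm_le0 _ 2 3) => //.
  have := AzS ord0; rewrite eqxx mul1n => /(canRL (addKr _)) A3.
  rewrite -normrMn A3 (le_trans (ler_normD _ _)) // normrN normrM z1 mul1r mulr2n.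
  rewrite [X in A i X](_ : _ = ord0); last exact: val_inj.
  have /(congr1 Num.norm) := Az0; rewrite normrN normrM z1 mul1r => <-.
  rewrite lerD2l [X in A i X](_ : _ = inord 1) ?normA //.
  by apply: val_inj; rewrite /= inordK.
have [->|j0] := eqVneq j ord0.
  apply: normr0_eq0; rewrite -[LHS]mul1r -z1 -normrM -Az0 Amax.
  by rewrite normrN normr0.
apply: normr0_eq0; rewrite -[j]inord_val normA ?Amax ?normr0 // lt0n.
by move: j0; rewrite -val_eqE /= => ->; rewrite leq_ord.
Qed.

Definition gmx : 'M[int]_2 := \matrix_(i, j)
  nth 0 (nth [::] [:: [:: 0; 1]; [:: -1; 9]] i) j.

Lemma gmx_unit : gmx \in unitmx.
Proof.
by rewrite unitmxE (expand_det_row _ ord0) big_ord_recl big_ord1 /cofactor !det_mx11 !mxE.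
Qed.

Lemma mul_gmx (K : pzRingType) k (A : 'M[K]_(2, k)) j :
  (map_mx intr gmx *m A) ord0 j = A ord_max j /\
  (map_mx intr gmx *m A) ord_max j = A ord_max j *+ 9 - A ord0 j.
Proof.
split; rewrite mxE big_ord_recl big_ord1 !mxE /=.
  rewrite mul0r add0r mul1r; congr (A _ _); exact: val_inj.
rewrite mulN1r addrC mulr_natl; congr (A _ _ *+ _ - _); exact: val_inj.
Qed.

(** The rows satisfy z A_0 = A_1 and z A_1 = 9 A_1 - A_0, whence 9 |A_1| <= |A_1| + |A_0| = 2 |A_1|
    entrywise. *)
Lemma gmx_hyperbolic k (z : C) (A : 'M_(2, k)) :
  `|z| = 1 -> map_mx intr gmx *m A = z *: A -> A = 0.
Proof.
move=> z1 Az.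
have A0 j : A ord_max j = 0.
  have [] := mul_gmx A j; rewrite Az !mxE => E0 E1.
  apply: (@mulrn_norm_le0 _ 2 9) => //; move/esym/(canRL (subrK _)): E1.
  rewrite -normrMn => ->; rewrite (le_trans (ler_normD _ _)) // normrM z1 mul1r.
  by rewrite -E0 normrM z1 mul1r mulr2n.
apply/matrixP => i j; rewrite mxE.
have [] := mul_gmx A j; rewrite Az !mxE A0 => /eqP.
have z0 : z != 0 by rewrite -normr_eq0 z1 oner_eq0.
rewrite mulf_eq0 (negPf z0) /= => /eqP A00 _.
case: (unliftP ord_max i) => [i' ->|->//].
by rewrite -A00; congr (A _ _); apply: val_inj; rewrite (ord1 i').
Qed.

Let norm1 k (t : 'rV[C]_k) := \sum_j `|t 0 j|.

Let sum_ord0_mulrn a (x : C) : \sum_(j < a.+1) x *+ ((j == ord0) * 3) = x *+ 3.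
Proof. by rewrite big_ord_recl eqxx mul1n big1 ?addr0. Qed.

(** Up to sign, multiplication by h permutes the coordinates and adds 3 times the last one to one of
    them. *)
Lemma norm1_cmx a (t : 'rV[C]_a.+2) :
  norm1 (t *m map_mx intr (cmx a)) <= norm1 t *+ 4.
Proof.
apply: le_trans (_ : norm1 t + `|t 0 ord_max| *+ 3 <= _); last first.
  rewrite [leRHS]mulrS lerD2l lerMn2r /norm1 big_ord_recr /=.
  by rewrite lerDr sumr_ge0 ?orbT.
rewrite /norm1 big_ord_recl mul_cmx0 normrN [in leRHS]big_ord_recr /=.
rewrite [leLHS]addrC [leRHS]addrAC lerD2r -(sum_ord0_mulrn a) -big_split /=.
apply: ler_sum => j _; rewrite mul_cmxS (le_trans (ler_normD _ _)) //.
by rewrite normrMn.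
Qed.

(** The inverse has the same shape: the last coordinate of [t] is minus the first one of [th], and 3
    times it is subtracted once. *)
Lemma norm1_cmxV a (t : 'rV[C]_a.+2) :
  norm1 t <= norm1 (t *m map_mx intr (cmx a)) *+ 4.
Proof.
set th := t *m _.
have th0 : `|th 0 ord0| = `|t 0 ord_max| by rewrite mul_cmx0 normrN.
apply: le_trans (_ : norm1 th + `|th 0 ord0| *+ 3 <= _); last first.
  rewrite [leRHS]mulrS lerD2l lerMn2r /norm1 big_ord_recl.
  by rewrite lerDl sumr_ge0 ?orbT.
rewrite /norm1 [in leRHS]big_ord_recl th0 big_ord_recr /=.
rewrite [leLHS]addrC -[leRHS]addrA lerD2l -(sum_ord0_mulrn a) -big_split /=; apply: ler_sum => j _.
have := mul_cmxS t 0 j; rewrite -/th => /esym /(canRL (addrK _)) ->.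
by rewrite (le_trans (ler_normB _ _)) // normrMn.
Qed.

(** The rows satisfy t1 h = z t0 and (9 t1 - t0) h = z t1. Hence 9 |t1 h| <= |t1| + |t0 h|, where
    |t1| <= 4 |t1 h| and |t0 h| = |(t1 h) h| <= 4 |t1 h|, so t1 h = 0. *)
Lemma gmx_cmx_hyperbolic a (z : C) (A : 'M_(2, a.+2)) :
  `|z| = 1 -> map_mx intr gmx *m A *m map_mx intr (cmx a) = z *: A -> A = 0.
Proof.
move=> z1; set h := map_mx intr (cmx a) => Az.
have rowA i : row i (map_mx intr gmx *m A) *m h = z *: row i A.
  by rewrite -row_mul Az; apply/rowP => j; rewrite !mxE.
pose t0 := row ord0 A; pose t1 := row ord_max A.
have E0 : t1 *m h = z *: t0.
  rewrite -rowA; congr (_ *m _); apply/rowP => j.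
  by rewrite [RHS]mxE (proj1 (mul_gmx _ _)) mxE.
have E1 : (t1 *+ 9 - t0) *m h = z *: t1.
  rewrite -rowA; congr (_ *m _); apply/rowP => j.
  by rewrite [RHS]mxE (proj2 (mul_gmx _ _)) !(mulmxnE, mxE).
have norm1Z k x (t : 'rV[C]_k) : `|x| = 1 -> norm1 (x *: t) = norm1 t.
  by move=> x1; apply: eq_bigr => j _; rewrite mxE normrM x1 mul1r.
have norm1D k (t u : 'rV[C]_k) : norm1 (t + u) <= norm1 t + norm1 u.
  rewrite -big_split; apply: ler_sum => j _; rewrite mxE; exact: ler_normD.
have norm1Mn k (t : 'rV[C]_k) d : norm1 (t *+ d) = norm1 t *+ d.
  by rewrite -sumrMnl; apply: eq_bigr => j _; rewrite mulmxnE normrMn.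
have norm1_ge0 k (t : 'rV[C]_k) : 0 <= norm1 t by exact: sumr_ge0.
have norm1_eq0 k (t : 'rV[C]_k) : norm1 t = 0 -> t = 0.
  move=> /eqP; rewrite psumr_eq0 // => /allP t_eq0; apply/rowP => j.
  by rewrite mxE; apply/normr0_eq0/eqP/t_eq0; rewrite mem_index_enum.
have t1h0 : norm1 (t1 *m h) = 0.
  apply: (@mulrn_le_eq0 _ 8 9) => //.
  have -> : norm1 (t1 *m h) *+ 9 = norm1 (z *: t1 + t0 *m h).
    by rewrite -norm1Mn -E1 mulmxBl subrK; congr norm1; rewrite [RHS](raddfMn (mulmxr h)).
  rewrite (le_trans (norm1D _ _ _)) // norm1Z // -(norm1Z _ z (t0 *m h)) //.
  rewrite scalemxAl -E0 -[8%N]/(4 + 4)%N mulrnDr.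
  by rewrite lerD ?norm1_cmx ?norm1_cmxV.
have t1_0 : t1 = 0.
  apply: norm1_eq0; apply/eqP; rewrite eq_le norm1_ge0 andbT.
  by rewrite (le_trans (norm1_cmxV _)) // -/h t1h0 mul0rn.
have t0_0 : t0 = 0.
  apply/eqP; have := E0; rewrite t1_0 mul0mx => /esym/eqP.
  by rewrite scaler_eq0 -normr_eq0 z1 oner_eq0.
apply/row_matrixP => i; rewrite row0; case: (unliftP ord_max i) => [i' ->|->//].
by rewrite -t0_0; congr (row _ _); apply: val_inj; rewrite (ord1 i').
Qed.
End Hyperbolicity.

(** * Index pairs for the exterior square *)

Section WedgePairs.
Variable d : nat.

(** An explicit list, ordered by the larger index first, so that for a concrete [d] its size and
    entries are obtained by computation. *)
Definition pairs : seq (nat * nat) :=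
  [seq (i, j) | j <- iota 0 d.+2, i <- iota 0 j].
Local Notation w := (size pairs).

Definition pairl (l : 'I_w) : 'I_d.+2 := inord (nth (0, 0)%N pairs l).1.
Definition pairr (l : 'I_w) : 'I_d.+2 := inord (nth (0, 0)%N pairs l).2.

Lemma mem_pairs i j : ((i, j) \in pairs) = (i < j < d.+2)%N.
Proof.
apply/allpairsPdep/idP => [[j' [i' [+ + [-> ->]]]]|/andP[ij jd]].
  by rewrite !mem_iota !add0n /= => -> ->.
by exists j, i; rewrite !mem_iota !add0n.
Qed.

Lemma pairs_uniq : uniq pairs.
Proof.
apply: allpairs_uniq_dep => [|j _|[j i] [j' i'] _ _ [-> ->] //]; exact: iota_uniq.
Qed.

Lemma nth_pairsE (l : 'I_w) : nth (0, 0)%N pairs l = (pairl l : nat, pairr l : nat).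
Proof.
have := mem_nth (0, 0)%N (ltn_ord l); rewrite /pairl /pairr.
case: (nth _ _ _) => i j; rewrite mem_pairs => /andP[ij jd].
by rewrite !inordK // (ltn_trans ij).
Qed.

Lemma ltn_pair l : (pairl l < pairr l)%N.
Proof.
by have := mem_nth (0, 0)%N (ltn_ord l); rewrite nth_pairsE mem_pairs => /andP[].
Qed.

Lemma pair_inj l l' : pairl l = pairl l' -> pairr l = pairr l' -> l = l'.
Proof.
move=> ll rr; apply/val_inj/eqP; rewrite /= -(nth_uniq (0, 0)%N _ _ pairs_uniq) //.
by rewrite !nth_pairsE ll rr.
Qed.

Lemma pair_cover (i j : 'I_d.+2) :
  (i < j)%N -> exists2 l, pairl l = i & pairr l = j.
Proof.
move=> ij; have ijP : (i : nat, j : nat) \in pairs by rewrite mem_pairs ij /=.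
have lt_w : (index (i : nat, j : nat) pairs < w)%N by rewrite index_mem.
by exists (Ordinal lt_w); rewrite /pairl /pairr /= nth_index //= inord_val.
Qed.

Lemma sum_pairs (V : zmodType) (G : 'I_d.+2 -> 'I_d.+2 -> V) :
  (forall i, G i i = 0) ->
  \sum_i \sum_j G i j = \sum_l (G (pairl l) (pairr l) + G (pairr l) (pairl l)).
Proof.
move=> G0.
have pairsE (H : 'I_d.+2 -> 'I_d.+2 -> V) :
    \sum_l H (pairl l) (pairr l) = 
      \sum_(ij : 'I_d.+2 * 'I_d.+2 | (ij.1 < ij.2)%N) H ij.1 ij.2.
  rewrite -[RHS]big_filter -(big_map (fun l => (pairl l, pairr l)) predT
    (fun ij => H ij.1 ij.2)).
  apply: perm_big; apply: uniq_perm.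
  - by rewrite map_inj_uniq ?index_enum_uniq // => l l' [/pair_inj]; apply.
  - by rewrite filter_uniq ?index_enum_uniq.
  move=> [i j]; rewrite mem_filter mem_index_enum andbT /=.
  apply/mapP/idP => [[l _ [-> ->]]|/pair_cover[l <- <-]]; first exact: ltn_pair.
  by exists l; rewrite ?mem_index_enum.
rewrite big_split /= (pairsE G) (pairsE (fun j i => G i j)).
rewrite pair_big /= (bigID (fun ij : 'I_d.+2 * 'I_d.+2 => (ij.1 < ij.2)%N)) /=.
congr (_ + _); rewrite (bigID (fun ij : 'I_d.+2 * 'I_d.+2 => ij.1 == ij.2)) /=.
rewrite big1 ?add0r => [|[i j] /andP[_ /eqP /= ->] //].
(* Exchanging the indices turns the remaining sum over i > j into the second sum over pairs. *)
have swap_inj : injective (fun ij : 'I_d.+2 * 'I_d.+2 => (ij.2, ij.1)).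
  by move=> [i j] [i' j'] [-> ->].
rewrite (reindex_inj swap_inj) /=.
by apply: eq_bigl => -[i j] /=; rewrite -leqNgt -val_eqE /= eq_sym ltn_neqAle andbC.
Qed.

End WedgePairs.

(** * The wedge algebras *)

Section WedgeAlgebra.
Variable d : nat.
Local Notation w := (size (pairs d)).
Local Notation pi := (@pairl d).
Local Notation pj := (@pairr d).

(** The rows of [x] and [y] are the k vectors; the result is in coordinates on the e_i ^ e_j with i
    < j. *)
Definition wedge (K : comNzRingType) k (x y : 'M[K]_(k, d.+2)) : 'M[K]_(1, w) :=
  \matrix_(i, l) \sum_r (x r (pi l) * y r (pj l) - x r (pj l) * y r (pi l)).

(** The second compound matrix of 2 x 2 minors, that is, the action of [M] on the exterior
    square. *)
Definition compound (K : comNzRingType) (M : 'M[K]_d.+2) : 'M[K]_w :=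
  \matrix_(l, m) (M (pi l) (pi m) * M (pj l) (pj m)
    - M (pi l) (pj m) * M (pj l) (pi m)).

(** Cauchy-Binet for 2 x 2 minors: [G] vanishes on the diagonal, and its terms at (p, q) and (q, p)
    combine into a wedge coordinate times a minor of [M]. *)
Lemma wedge_mul (K : comNzRingType) k (x y : 'M[K]_(k, d.+2)) M :
  wedge (x *m M) (y *m M) = wedge x y *m compound M.
Proof.
apply/matrixP => i m; rewrite !mxE.
under [RHS]eq_bigr do rewrite mxE mulr_suml.
rewrite exchange_big; apply: eq_bigr => r _ /=; rewrite !mxE.
pose G p q := x r p * y r q * (M p (pi m) * M q (pj m) - M p (pj m) * M q (pi m)).
transitivity (\sum_p \sum_q G p q).
  rewrite !big_distrlr -sumrB; apply: eq_bigr => p _.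
  rewrite -sumrB; apply: eq_bigr => q _; rewrite /G /=; ring.
rewrite sum_pairs => [|p]; last by rewrite /G mulrC [X in X - _]mulrC subrr mul0r.
by apply: eq_bigr => l _; rewrite /G !mxE; ring.
Qed.

Lemma compound1 (K : comNzRingType) : compound 1%:M = 1%:M :> 'M[K]_w.
Proof.
apply/matrixP => l m; rewrite !mxE -!natrM !mulnb.
have ij0 : (pi l == pj m) && (pj l == pi m) = false.
  apply/negP => /andP[/eqP ij /eqP ji].
  by have := ltn_pair l; rewrite ij ji => /(ltn_trans (ltn_pair m)); rewrite ltnn.
rewrite ij0 subr0; congr (nat_of_bool _)%:R.
by apply/andP/eqP => [[/eqP ii /eqP jj]|->//]; apply: pair_inj.
Qed.

(** Each row of a compound matrix is the wedge of two rows, so [wedge_mul] applies row by row. *)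
Lemma compoundM (K : comNzRingType) (M N : 'M[K]_d.+2) :
  compound (M *m N) = compound M *m compound N.
Proof.
have rowC (M' : 'M[K]_d.+2) l :
    row l (compound M') = wedge (row (pi l) M') (row (pj l) M').
  by apply/rowP => m; rewrite !mxE big_ord1 !mxE.
by apply/row_matrixP => l; rewrite row_mul !rowC !row_mul wedge_mul.
Qed.

Lemma compound_unit (M : 'M[int]_d.+2) : M \in unitmx -> compound M \in unitmx.
Proof.
move=> uM; have : compound M *m compound (invmx M) = 1%:M.
  by rewrite -compoundM mulmxV // compound1.
by case/mulmx1_unit.
Qed.

Lemma map_compound (K K' : comNzRingType) (f : {rmorphism K -> K'}) M :
  map_mx f (compound M) = compound (map_mx f M).
Proof. by apply/matrixP => l m; rewrite !mxE rmorphB !rmorphM. Qed.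

Variable k : nat.

Definition wedge_lie (F : numFieldType) (u v : mxU k d.+2 0 0 F) := wedge u.1 v.1.

Lemma wedge_alternating (F : numFieldType) : alternating_bilinear (@wedge_lie F).
Proof.
split=> [v a u u'|u a v v'|u]; apply/matrixP => i l; rewrite !mxE.
- rewrite mulr_sumr -big_split; apply: eq_bigr => r _; rewrite /= !mxE; ring.
- rewrite mulr_sumr -big_split; apply: eq_bigr => r _; rewrite /= !mxE; ring.
- by rewrite big1 // => r _; rewrite mulrC subrr.
Qed.

Lemma map_wedge (F F' : numFieldType) (f : {rmorphism F -> F'}) u v :
  map_mx f (wedge_lie u v) = wedge_lie (map_mxU f u) (map_mxU f v).
Proof.
apply/matrixP => i l; rewrite !mxE rmorph_sum; apply: eq_bigr => r _.
by rewrite rmorphB !rmorphM !mxE.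
Qed.

Section Indecomposable.
Variable F : numFieldType.
Local Notation U := (mxU k d.+2 0 0 F).
Let e r i : U := (delta_mx r i, 0).

Lemma wedge_e (u : U) s j l :
  wedge_lie u (e s j) 0 l =
  u.1 s (pi l) *+ (pj l == j) - u.1 s (pj l) *+ (pi l == j).
Proof.
rewrite mxE (bigD1 s) //= big1 ?addr0 => [|r /negPf r_s].
  by rewrite !mxE eqxx /= !mulr_natr.
by rewrite !mxE r_s /= !mulr0 subrr.
Qed.

(** The bracket with [e s j] is the wedge of the vector u_s with e_j, which vanishes only if u_s is
    a multiple of e_j. *)
Lemma wedge_e_eq0 (u : U) s i j : wedge_lie u (e s j) = 0 -> i != j -> u.1 s i = 0.
Proof.
move=> /matrixP we0 ij; have /negPf ij0 := ij.
move: ij; rewrite neq_ltn => /orP[] /pair_cover[l li lj];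
  have := we0 0 l; rewrite wedge_e li lj eqxx mxE ij0 mulr0n.
  by rewrite subr0.
by move/eqP; rewrite sub0r oppr_eq0 => /eqP.
Qed.

Lemma wedge_ee r l : wedge_lie (e r (pi l)) (e r (pj l)) = delta_mx 0 l.
Proof.
apply/matrixP => i l'; rewrite (ord1 i) wedge_e /= !mxE !eqxx /=.
have ij0 : (pj l' == pi l) && (pi l' == pj l) = false.
  apply/negP => /andP[/eqP ji /eqP ij].
  by have := ltn_pair l'; rewrite ij ji => /(ltn_trans (ltn_pair l)); rewrite ltnn.
have -> : (l' == l) = (pi l' == pi l) && (pj l' == pj l).
  by apply/eqP/andP => [->//|[/eqP ii /eqP jj]]; apply: pair_inj.
by rewrite -!mulrnA !mulnb ij0 subr0.
Qed.

Lemma mxU0_eq (u v : U) : u.1 = v.1 -> u = v.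
Proof.
by case: u v => [u1 u2] [v1 v2] /= ->; rewrite [u2]flatmx0 [v2]flatmx0.
Qed.

End Indecomposable.

(** A centroid element preserves commutation, which forces f (e r i) = c r i *: e r i. Evaluating
    [h] on e_i ^ e_j gives both c r i and c r j, for every r; as [h] does not involve r, all these
    scalars agree. *)
Lemma wedge_indecomposable (F : numFieldType) :
  (0 < k)%N -> indecomposable (two_step (wedge_alternating F)).
Proof.
move=> k_gt0; pose r0 := Ordinal k_gt0.
pose e r i : mxU k d.+2 0 0 F := (delta_mx r i, 0).
have other (i : 'I_d.+2) : exists j, i != j.
  by exists (if i == ord0 then ord_max else ord0); case: (eqVneq i ord0) => [->|].
apply: (two_step_indecomposable (u0 := e r0 ord0)).
- apply/eqP => /(congr1 (fun u : mxU k d.+2 0 0 F => u.1 r0 ord0)) /eqP.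
  by rewrite !mxE !eqxx oner_eq0.
- move=> u u0; apply: mxU0_eq; apply/matrixP => r i; rewrite [RHS]mxE.
  by have [j ij] := other i; apply: wedge_e_eq0 ij; apply: u0.
- move=> f f0; apply/lfunP => z; rewrite [z]row_sum_delta linear_sum zero_lfunE.
  by rewrite big1 // => l _; rewrite linearZ /= -(wedge_ee F r0) f0 scaler0.
move=> f h hl hr.
pose c r i := (f (e r i)).1 r i.
have fe r i : f (e r i) = c r i *: e r i.
  apply: mxU0_eq; apply/matrixP => s j; rewrite /= !mxE.
  (* Whatever commutes with [e r i] commutes with its image under [f]. *)
  have wf0 s' i' : (s' != r) || (i' == i) -> wedge_lie (f (e r i)) (e s' i') = 0.
    move=> sr; rewrite -hl; suff -> : wedge_lie (e r i) (e s' i') = 0 by rewrite linear0.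
    apply/rowP => l; rewrite wedge_e /= !mxE.
    case/orP: sr => [/negPf-> | /eqP->]; first by rewrite !mul0rn subrr.
    by rewrite -!mulrnA !mulnb -!andbA [(pi l == i) && _]andbC subrr.
  have [->|sr] := eqVneq s r; have [->|ji] := eqVneq j i.
  + by rewrite mulr1.
  + by rewrite mulr0; apply: (wedge_e_eq0 _ ji); apply: wf0; rewrite !eqxx orbT.
  + have [j' ij'] := other i; rewrite mulr0; apply: (wedge_e_eq0 _ ij').
    by apply: wf0; rewrite sr.
  + have [j' jj'] := other j; rewrite mulr0; apply: (wedge_e_eq0 _ jj').
    by apply: wf0; rewrite sr.
have hi r l : h (delta_mx 0 l) = c r (pi l) *: delta_mx 0 l.
  rewrite -(wedge_ee F r) hl fe.
  exact: (altZl (wedge_alternating F)).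
have hj r l : h (delta_mx 0 l) = c r (pj l) *: delta_mx 0 l.
  rewrite -(wedge_ee F r) hr fe.
  have := alt_linearr (wedge_alternating F) (e r (pi l)) (c r (pj l)) (e r (pj l)) 0.
  by rewrite !addr0 (alt0r (wedge_alternating F)) addr0.
have delta_inj (a b : F) l : a *: delta_mx 0 l = b *: delta_mx 0 l :> 'M_(1, w) -> a = b.
  by move/rowP/(_ l); rewrite !mxE !eqxx !mulr1.
have c_const r i : c r i = c r0 ord0.
  have [->|i0] := eqVneq i ord0.
    have [|l li _] := @pair_cover d ord0 ord_max => //.
    by apply: (delta_inj _ _ l); rewrite -li -!hi.
  have [|l li lj] := @pair_cover d ord0 i; first by rewrite lt0n.
  by apply: (delta_inj _ _ l); rewrite -li -lj -hi -hj.
exists (c r0 ord0) => u.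
pose inj (A : 'M[F]_(k, d.+2)) : mxU k d.+2 0 0 F := (A, 0).
have -> : u = inj (map_mx id u.1) by apply: mxU0_eq; rewrite /= map_mx_id.
apply: (matrix_closure (P := fun A => f (inj A) = _ *: inj A)).
- by have -> : inj 0 = 0 by []; rewrite linear0 scaler0.
- move=> A B fA fB; have -> : inj (A + B) = inj A + inj B by exact: mxU0_eq.
  by rewrite linearD fA fB scalerDr.
- move=> b r i; have -> : inj (b *: delta_mx r i) = b *: e r i by exact: mxU0_eq.
  by rewrite linearZ /= fe c_const !scalerA mulrC.
Qed.
End WedgeAlgebra.

(** * The Krylov algebras, with bracket x K(t') - x' K(t) *)

Section KrylovAlgebra.
Variables (a w : nat).

Definition krylov (K : pzRingType) (t : 'rV[K]_a.+2) : 'M[K]_(w, a.+2) :=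
  \matrix_(j, l) (t *m map_mx intr (cmx a) ^+ j) 0 l.

Definition krylov_lie (F : numFieldType) (u v : mxU 2 w 1 a.+2 F) :
    'M[F]_(2, a.+2) :=
  u.1 *m krylov v.2 - v.1 *m krylov u.2.

Section Ring.
Variable K : comNzRingType.

Lemma krylov_is_linear : linear (@krylov K).
Proof. by move=> x t t'; apply/matrixP => j l; rewrite mxE mulmxDl -scalemxAl !mxE. Qed.

HB.instance Definition _ := GRing.isLinear.Build K 'rV[K]_a.+2 'M[K]_(w, a.+2)
  *:%R (@krylov K) krylov_is_linear.

Lemma row_krylov j (t : 'rV[K]_a.+2) :
  row j (krylov t) = t *m map_mx intr (cmx a) ^+ j.
Proof. by apply/rowP => l; rewrite !mxE. Qed.

(** The matrix h commutes with its powers; this makes the bracket equivariant. *)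
Lemma krylovM (t : 'rV[K]_a.+2) :
  krylov (t *m map_mx intr (cmx a)) = krylov t *m map_mx intr (cmx a).
Proof.
apply/row_matrixP => j; rewrite row_mul.
by rewrite !row_krylov -!mulmxA -[_ *m _ ^+ _]exprS -[_ ^+ _ *m _]exprSr.
Qed.

(* Multiplication by the companion matrix is the shift as long as the support
   stays away from the last coordinate. *)
Lemma mul_cmxX_top i m (s : 'rV[K]_a.+2) :
  (m + i <= a.+1)%N -> (forall l : 'I_a.+2, (m < l)%N -> s 0 l = 0) ->
  (s *m map_mx intr (cmx a) ^+ i) 0 (inord (m + i)) = s 0 (inord m).
Proof.
elim: i m s => [|i IHi] m s mi s0; first by rewrite addn0 expr0 mulmx1.
have smax : s 0 ord_max = 0 by apply: s0 => /=; lia.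
have sS (l : 'I_a.+1) : (s *m map_mx intr (cmx a)) 0 (lift ord0 l)
    = s 0 (widen_ord (leqnSn _) l) by rewrite mul_cmxS smax mul0rn addr0.
rewrite exprS mulmxA addnS -addSn IHi; first last.
- move=> l; case: (unliftP ord0 l) => [l' ->|-> //]; rewrite lift0 ltnS => ml.
  by rewrite sS s0.
- by lia.
have m_lt : (m < a.+1)%N by lia.
rewrite (_ : inord m.+1 = lift ord0 (Ordinal m_lt)); last first.
  by apply: val_inj; rewrite /= /bump inordK.
by rewrite sS; congr (s 0 _); apply: val_inj; rewrite /= inordK //; lia.
Qed.

(** Consequently K(e0) consists of the first w rows of the identity, and x can be read off from x
    K(e0). *)
Lemma cmxX_delta i :
  (i < a.+2)%N ->
  delta_mx 0 ord0 *m map_mx intr (cmx a) ^+ i = delta_mx 0 (inord i) :> 'rV[K]_a.+2.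
Proof.
elim: i => [_|i IHi ltia].
  rewrite expr0 mulmx1; congr delta_mx; apply: val_inj; rewrite /= inordK //.
rewrite exprSr mulmxA IHi ?(ltnW ltia) // -rowE; apply/rowP => l; rewrite !mxE.
have -> : (inord i == ord_max :> 'I_a.+2) = false.
  by rewrite -val_eqE /= inordK; lia.
rewrite eqxx -val_eqE /= !inordK ?(ltnW ltia) //; exact: rmorph_nat.
Qed.

End Ring.

Lemma krylov_alternating (F : numFieldType) : alternating_bilinear (@krylov_lie F).
Proof.
split=> [v x u u'|u x v v'|u]; rewrite /krylov_lie /=; last by rewrite subrr.
- rewrite linearP mulmxDl mulmxDr scalerBr -!scalemxAl -!scalemxAr.
  by rewrite opprD addrACA.
- rewrite linearP mulmxDl mulmxDr scalerBr -!scalemxAl -!scalemxAr.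
  by rewrite opprD addrACA.
Qed.

Lemma map_krylov_lie (F F' : numFieldType) (f : {rmorphism F -> F'}) u v :
  map_mx f (krylov_lie u v) = krylov_lie (map_mxU f u) (map_mxU f v).
Proof.
have mapK t : map_mx f (krylov t) = krylov (map_mx f t).
  have mapX j : map_mx f (t *m map_mx intr (cmx a) ^+ j) =
      map_mx f t *m map_mx intr (cmx a) ^+ j.
    by rewrite map_mxM rmorphXn /= map_mx_intr.
  by apply/matrixP => j l; rewrite [RHS]mxE -mapX [RHS]mxE !mxE.
by rewrite /krylov_lie map_mxB !map_mxM !mapK.
Qed.

(** Commutation relations make [f] preserve both parts of U, as [al] and [ep] with al(x) K(t) = x
    K(ep t). For s = ep e0 this puts s, s h, ..., s h^(w-1) in the span of the first w coordinate
    vectors, and since w < m the shift by h then forces s = c e0. Reading al on e0 spreads this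
    scalar to all of U. *)
Lemma krylov_indecomposable (F : numFieldType) :
  (0 < w <= a.+1)%N -> indecomposable (two_step (krylov_alternating F)).
Proof.
case/andP=> w_gt0 w_le; pose U := mxU 2 w 1 a.+2 F; pose j0 := Ordinal w_gt0.
set h := map_mx intr (cmx a) : 'M[F]_a.+2; pose e0 : 'rV[F]_a.+2 := delta_mx 0 ord0.
pose inx (x : 'M[F]_(2, w)) : U := (x, 0); pose inT (t : 'rV[F]_a.+2) : U := (0, t).
have lie_xt x t : krylov_lie (inx x) (inT t) = x *m krylov t.
  by rewrite /krylov_lie /= mul0mx subr0.
have lie_xx x u : krylov_lie u (inx x) = - (x *m krylov u.2).
  by rewrite /krylov_lie /= linear0 mulmx0 sub0r.
have lie_tt t u : krylov_lie u (inT t) = u.1 *m krylov t.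
  by rewrite /krylov_lie /= mul0mx subr0.
have widen_w (j : 'I_w) : (j < a.+2)%N by have := ltn_ord j; lia.
have krylov_e0 k (x : 'M[F]_(k, w)) r (j : 'I_w) : (x *m krylov e0) r (inord j) = x r j :> F.
  rewrite mxE (bigD1 j) //= big1 ?addr0 => [|i /negPf ij]; rewrite mxE cmxX_delta // mxE.
    by rewrite !eqxx mulr1.
  by rewrite eqxx -(val_eqE (inord j)) /= !inordK // eq_sym [_ == _]ij mulr0.
have krylov_e0_inj k (x : 'M[F]_(k, w)) : x *m krylov e0 = 0 -> x = 0.
  by move=> x0; apply/matrixP => r j; rewrite -krylov_e0 x0 !mxE.
(* The first row of K(t) is t itself. *)
have row_delta0 k (r : 'I_k) (t : 'rV[F]_a.+2) : row r (delta_mx r j0 *m krylov t) = t.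
  rewrite row_mul (_ : row r _ = delta_mx 0 j0); last first.
    by apply/rowP => j; rewrite !mxE eqxx.
  by rewrite -rowE row_krylov expr0 mulmx1.
have krylov_inj (t : 'rV[F]_a.+2) : (forall x : 'M[F]_(2, w), x *m krylov t = 0) -> t = 0.
  by move=> t0; rewrite -[t](row_delta0 2 ord0) t0 row0.
apply: (two_step_indecomposable (u0 := inT e0)).
- apply/eqP => /(congr1 (fun u : U => u.2 0 ord0)) /eqP.
  by rewrite !mxE !eqxx oner_eq0.
- move=> [x t] u0.
  have -> : t = 0.
    by apply: krylov_inj => y; apply/eqP; rewrite -oppr_eq0 -(lie_xx y (x, t)) u0.
  by congr pair; apply: krylov_e0_inj; rewrite -(lie_tt e0 (x, t)) u0.
- move=> f f0; apply/lfunP => z; rewrite zero_lfunE -[z](map_mx_id (f := id)) //.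
  apply: (matrix_closure (P := fun z => f z = 0)) => [|A B fA fB|c r l].
  + by rewrite linear0.
  + by rewrite linearD /= fA fB addr0.
  rewrite linearZ /= (_ : delta_mx r l = krylov_lie (inx (delta_mx r j0)) (inT (delta_mx 0 l))).
    by rewrite f0 scaler0.
  rewrite lie_xt; apply/row_matrixP => i.
  have [->|ir] := eqVneq i r.
    by rewrite row_delta0; apply/rowP => l'; rewrite !mxE eqxx.
  rewrite row_mul (_ : row i (delta_mx r j0) = 0) ?mul0mx.
    by apply/rowP => l'; rewrite !mxE (negPf ir).
  by apply/rowP => l'; rewrite !mxE (negPf ir).
move=> f phi phi_l phi_r.
pose al x := (f (inx x)).1; pose ep t := (f (inT t)).2.
(* The x-part is abelian, so the t-component of the image is killed by every x'; for [ft] below,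
   bracketing with e0 suffices. *)
have fx x : f (inx x) = inx (al x).
  rewrite /al; case E: (f (inx x)) => [y t] /=; congr pair; apply: krylov_inj => x'.
  apply/eqP; rewrite -oppr_eq0 -(lie_xx x' (y, t)) -E -phi_l lie_xx /= linear0.
  by rewrite mulmx0 oppr0 linear0.
have ft t : f (inT t) = inT (ep t).
  rewrite /ep; case E: (f (inT t)) => [y t'] /=; congr pair; apply: krylov_e0_inj.
  by rewrite -(lie_tt e0 (y, t')) -E -phi_l lie_tt mul0mx linear0.
have al_ep x (t : 'rV[F]_a.+2) : al x *m krylov t = x *m krylov (ep t).
  by rewrite -!lie_xt -fx -ft -phi_l phi_r.
pose s := ep e0.
(* Taking for x a matrix with a single entry 1 in its first row selects the row t h^i of K(t). *)
have row_ep i (t : 'rV[F]_a.+2) : row ord0 (al (delta_mx ord0 i)) *m krylov t = ep t *m h ^+ i.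
  rewrite -row_mul al_ep row_mul (_ : row _ _ = delta_mx 0 i); last first.
    by apply/rowP => j; rewrite !mxE eqxx.
  by rewrite -rowE row_krylov.
have supp i (l : 'I_a.+2) : (w <= l)%N -> (s *m h ^+ (i : 'I_w)) 0 l = 0.
  move=> wl; rewrite -row_ep mxE big1 // => j _; rewrite [X in _ * X]mxE.
  rewrite cmxX_delta // [X in _ * X]mxE eqxx /= -val_eqE /= inordK //.
  by rewrite gtn_eqF ?mulr0 //; apply: leq_trans wl.
(* Downward induction on l < w: once the coordinates above l vanish, h^(w-l) shifts coordinate l to
   position w, where [supp] applies. The power is allowed because l > 0, and position w exists
   because w <= a + 1. *)
have s_gt (l : 'I_a.+2) : (0 < l)%N -> s 0 l = 0.
  have [wl _|lw] := leqP w l.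
    by have := supp j0 l wl; rewrite expr0 mulmx1.
  move: {2}(w - l)%N (leqnn (w - l)) => d; elim: d l lw => [|d IHd] l lw ld l0.
    by move: ld; rewrite leqn0 subn_eq0 leqNgt lw.
  have i_lt : (w - l < w)%N by lia.
  have := @mul_cmxX_top F (w - l) l s; rewrite -/h inord_val subnKC ?(ltnW lw) //.
  move=> <- //; first by rewrite (supp (Ordinal i_lt)) // inordK.
  move=> l' ll'; have [wl'|l'w] := leqP w l'; last by apply: IHd => //; lia.
  by have := supp j0 l' wl'; rewrite expr0 mulmx1.
pose c := s 0 ord0.
have sE : s = c *: e0.
  apply/rowP => l; rewrite !mxE eqxx /=; have [->|l0] := eqVneq l ord0.
    by rewrite mulr1.
  by rewrite mulr0 s_gt // lt0n.
have epE t : ep t = c *: t.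
  have := row_ep j0 t; rewrite expr0 mulmx1 => <-.
  have -> : row ord0 (al (delta_mx ord0 j0)) = c *: delta_mx 0 j0.
    apply/rowP => j; rewrite -krylov_e0 row_ep expr0 mulmx1 -/s sE !mxE eqxx.
    by rewrite -!val_eqE /= inordK.
  by rewrite -scalemxAl -rowE row_krylov expr0 mulmx1.
have alE x : al x = c *: x.
  apply/matrixP => r j.
  by rewrite -krylov_e0 al_ep epE linearZ -scalemxAr mxE krylov_e0 mxE.
exists c => -[x t].
have -> : (x, t) = inx x + inT t :> U by congr pair; rewrite /= ?addr0 ?add0r.
rewrite linearD fx ft alE epE scalerDr.
by congr pair; rewrite /= ?scaler0.
Qed.

End KrylovAlgebra.

(** * Hyperbolicity on the exterior square for vectors of length 3 and 4 *)

Section CompoundHyperbolicity.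

(** Phrased with natural numbers and list lookups, so that each entry evaluates once [d], [l] and
    [m] are concrete. *)
Lemma compound_cmxE d (l m : 'I_(size (pairs d))) :
  let c i j : int := if i == d.+1 then (j == 1%N)%:R *+ 3 - (j == 0%N)%:R
                     else (j == i.+1)%:R in
  let p := nth (0, 0)%N (pairs d) l in let q := nth (0, 0)%N (pairs d) m in
  compound (cmx d) l m = c p.1 q.1 * c p.2 q.2 - c p.1 q.2 * c p.2 q.1.
Proof. by rewrite /= !nth_pairsE !mxE. Qed.

Variable C : numFieldType.

(** The equations z t0 = t1, z t1 = t2 and z t2 = t0 - 3 t2 make all moduli equal, and then 3 |t2|
    <= 2 |t2|. *)
Lemma compound_hyperbolic3 (z : C) (A : 'M_(1, size (pairs 1))) :
  `|z| = 1 -> A *m map_mx intr (compound (cmx 1)) = z *: A -> A = 0.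
Proof.
(* The action of e0 -> e1 -> e2 -> 3 e1 - e0 on the wedges 01, 02, 12. *)
pose T : seq (seq int) := [:: [:: 0; 0; 1]; [:: 1; 0; 0]; [:: 0; 1; -3]].
have NE l m : compound (cmx 1) l m = nth 0 (nth [::] T l) m.
  by rewrite compound_cmxE; case: l => [[|[|[|l]]] //= _];
     case: m => [[|[|[|m]]] //= _].
(* With the matrix abstracted to [N], known only by its table, the dimension can be evaluated to
   3. *)
move: (compound (cmx 1)) NE A; rewrite [size _]/= => N NE A z1 Az.
pose t i := A 0 (inord i : 'I_3).
have tE j (ltj : (j < 3)%N) : z * t j =
    \sum_(i < 3) t i * (nth 0 (nth [::] T i) j)%:~R.
  have := congr1 (fun M : 'M_(1, 3) => M 0 (inord j)) Az; rewrite !mxE => <-.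
  by apply: eq_bigr => i _; rewrite mxE NE /t inord_val inordK.
have E0 : z * t 0%N = t 1%N by rewrite tE // !big_ord_recr big_ord0 /=; ring.
have E1 : z * t 1%N = t 2%N by rewrite tE // !big_ord_recr big_ord0 /=; ring.
have E2 : t 2%N *+ 3 = t 0%N - z * t 2%N.
  by rewrite tE // !big_ord_recr big_ord0 /=; ring.
have normz x : `|z * x| = `|x| by rewrite normrM z1 mul1r.
have t2_0 : t 2%N = 0.
  apply: (@mulrn_norm_le0 _ _ 2 3) => //.
  rewrite -normrMn E2 (le_trans (ler_normB _ _)) // normz -E1 normz -E0 normz.
  by rewrite mulr2n.
have z0 : z != 0 by rewrite -normr_eq0 z1 oner_eq0.
have cancel0 x : z * x = 0 -> x = 0 by move/eqP; rewrite mulf_eq0 (negPf z0) => /eqP.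
have t1_0 : t 1%N = 0 by apply: cancel0; rewrite E1.
have t0_0 : t 0%N = 0 by apply: cancel0; rewrite E0.
apply/rowP => i; rewrite mxE; have : t i = 0; last by rewrite /t inord_val.
by case: i => [[|[|[|i]]] //= _].
Qed.

(** The coordinates fall into two classes of equal modulus, {t0, t2, t3, t5} and {t1, t4}. The two
    equations with coefficient 3 bound each class by 2/3 of the other, so 9 |t0| <= 6 |t1| <= 4
    |t0|. *)
Lemma compound_hyperbolic4 (z : C) (A : 'M_(1, size (pairs 2))) :
  `|z| = 1 -> A *m map_mx intr (compound (cmx 2)) = z *: A -> A = 0.
Proof.
(* The wedges are ordered 01, 02, 12, 03, 13, 23. *)
pose T : seq (seq int) := [:: [:: 0; 0; 1; 0; 0; 0]; [:: 0; 0; 0; 0; 1; 0];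
  [:: 0; 0; 0; 0; 0; 1]; [:: 1; 0; 0; 0; 0; 0]; [:: 0; 1; -3; 0; 0; 0];
  [:: 0; 0; 0; 1; -3; 0]].
have NE l m : compound (cmx 2) l m = nth 0 (nth [::] T l) m.
  by rewrite compound_cmxE; case: l => [[|[|[|[|[|[|l]]]]]] //= _];
     case: m => [[|[|[|[|[|[|m]]]]]] //= _].
move: (compound (cmx 2)) NE A; rewrite [size _]/= => N NE A z1 Az.
pose t i := A 0 (inord i : 'I_6).
have tE j (ltj : (j < 6)%N) : z * t j =
    \sum_(i < 6) t i * (nth 0 (nth [::] T i) j)%:~R.
  have := congr1 (fun M : 'M_(1, 6) => M 0 (inord j)) Az; rewrite !mxE => <-.
  by apply: eq_bigr => i _; rewrite mxE NE /t inord_val inordK.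
have E0 : z * t 0%N = t 3%N by rewrite tE // !big_ord_recr big_ord0 /=; ring.
have E1 : z * t 1%N = t 4%N by rewrite tE // !big_ord_recr big_ord0 /=; ring.
have E2 : t 4%N *+ 3 = t 0%N - z * t 2%N.
  by rewrite tE // !big_ord_recr big_ord0 /=; ring.
have E3 : z * t 3%N = t 5%N by rewrite tE // !big_ord_recr big_ord0 /=; ring.
have E4 : t 5%N *+ 3 = t 1%N - z * t 4%N.
  by rewrite tE // !big_ord_recr big_ord0 /=; ring.
have E5 : z * t 5%N = t 2%N by rewrite tE // !big_ord_recr big_ord0 /=; ring.
have normz x : `|z * x| = `|x| by rewrite normrM z1 mul1r.
have le10 : `|t 1%N| *+ 3 <= `|t 0%N| *+ 2.
  rewrite -[`|t 1%N|]normz E1 -normrMn E2 (le_trans (ler_normB _ _)) // normz.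
  by rewrite -E5 normz -E3 normz -E0 normz mulr2n.
have le01 : `|t 0%N| *+ 3 <= `|t 1%N| *+ 2.
  rewrite -[`|t 0%N|]normz E0 -[`|t 3%N|]normz E3 -normrMn E4.
  by rewrite (le_trans (ler_normB _ _)) // normz -E1 normz mulr2n.
have t0_0 : t 0%N = 0.
  apply: (@mulrn_norm_le0 _ _ 4 9) => //.
  rewrite -[9%N]/(3 * 3)%N -[4%N]/(2 * 2)%N !mulrnA.
  by apply: le_trans (ler_wMn2r 3 le01) _; rewrite mulrnAC ler_wMn2r.
have t1_0 : t 1%N = 0.
  by apply: (@mulrn_norm_le0 _ _ 0 3) => //; move: le10; rewrite t0_0 normr0 mul0rn.
have t3_0 : t 3%N = 0 by rewrite -E0 t0_0 mulr0.
have t4_0 : t 4%N = 0 by rewrite -E1 t1_0 mulr0.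
have t5_0 : t 5%N = 0 by rewrite -E3 t3_0 mulr0.
have t2_0 : t 2%N = 0 by rewrite -E5 t5_0 mulr0.
apply/rowP => i; rewrite mxE; have : t i = 0; last by rewrite /t inord_val.
by case: i => [[|[|[|[|[|[|i]]]]]] //= _].
Qed.

End CompoundHyperbolicity.

(** * Both families are Anosov; choice of the parameters for each dimension *)

Section Families.
Variable R : realType.

Lemma wedge_anosov d k :
  (forall (z : R[i]) (A : 'M_(1, size (pairs d))), `|z| = 1 ->
     A *m map_mx intr (compound (cmx d)) = z *: A -> A = 0) ->
  anosov (two_step (@wedge_alternating d k R)).
Proof.
move=> hyp.
apply: (@two_step_anosov R _ _ _ _ _ _ (fun F => @wedge_lie d k F)
  (fun F => @wedge_alternating d k F) _ 1%:M (cmx d) 1%:M 1%:M 1%:M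
  (compound (cmx d))); rewrite ?unitmx1 ?cmx_unit ?compound_unit ?cmx_unit //.
- by move=> u v; apply: map_wedge.
- move=> u v; rewrite /wedge_lie /= !map_mx1 !mul1mx wedge_mul map_compound.
  by [].
- by move=> z A z1; rewrite map_mx1 mul1mx; apply: cmx_hyperbolic.
- by move=> z A _ _; apply: flatmx0.
- by move=> z A z1; rewrite map_mx1 mul1mx; apply: hyp.
Qed.

(** By [krylovM], (g x) K(t h) = g (x K(t)) h, so the action z -> g z h on Z is compatible with the
    bracket. *)
Lemma krylov_anosov a w : anosov (two_step (krylov_alternating a w R)).
Proof.
apply: (@two_step_anosov R _ _ _ _ _ _ (fun F => @krylov_lie a w F)
  (fun F => @krylov_alternating a w F) _ gmx 1%:M 1%:M (cmx a) gmx (cmx a));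
  rewrite ?unitmx1 ?cmx_unit ?gmx_unit //.
- by move=> u v; apply: map_krylov_lie.
- move=> u v; rewrite /krylov_lie /= !map_mx1 !mul1mx !mulmx1 !krylovM.
  by rewrite mulmxBr mulmxBl !mulmxA.
- by move=> z A z1; rewrite map_mx1 mulmx1; apply: gmx_hyperbolic.
- by move=> z A z1; rewrite map_mx1 mul1mx; apply: cmx_hyperbolic.
- by move=> z A z1; apply: gmx_cmx_hyperbolic.
Qed.

End Families.

Local Close Scope ring_scope.

Theorem mainTheorem1 (R : realType) (n : nat) (n_ge6 : (6 <= n)%N)
    (n_neq7 : n <> 7) :
  exists L : lieAlgType R,
    [/\ \dim (fullv : {vspace L}) = n, indecomposable L & anosov L].
Proof.
(* Here 10 = 4 + 6: one vector of length 4 and its exterior square. The Krylov family with w = 2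
   would need m = 2, against w < m. *)
have [->|n10] := eqVneq n 10.
  exists (two_step (@wedge_alternating 2 1 R)); split.
  - exact: dim_two_step.
  - exact: wedge_indecomposable.
  - apply: wedge_anosov; exact: compound_hyperbolic4.
have n3 := divn_eq n 3; move: n3 (ltn_pmod n (isT : (0 < 3)%N)).
case: (n %% 3)%N => [|[|[|//]]] n3 _.
(* For n = 3q: q - 1 >= 1 vectors of length 3 and an exterior square of dimension 3. *)
- exists (two_step (@wedge_alternating 1 (n %/ 3).-1 R)); split.
  + rewrite dim_two_step /=; lia.
  + apply: wedge_indecomposable; lia.
  + apply: wedge_anosov; exact: compound_hyperbolic3.
(* For n = 3q + 1: w = 2 and m = q - 1, so that 4 + 3m = n. Since 7 and 10 are excluded, q >= 4 and
   hence m > 2. *)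
- exists (two_step (krylov_alternating (n %/ 3 - 3) 2 R)); split.
  + rewrite dim_two_step /=; lia.
  + apply: krylov_indecomposable; lia.
  + exact: krylov_anosov.
(* For n = 3q + 2: w = 1 and m = q >= 2, so that 2 + 3m = n. *)
- exists (two_step (krylov_alternating (n %/ 3 - 2) 1 R)); split.
  + rewrite dim_two_step /=; lia.
  + apply: krylov_indecomposable; lia.
  + exact: krylov_anosov.
Qed.
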